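(* (Inductive soundness of S-resolution reductions.) Let $P$ be a logic program over a signature $\Sigma$ and let $t \in \mathbf{Term}(\Sigma)$. If $[t] \leadsto_{s,P}^n [\,]$ for some $n \in \mathbb{N}$ and this S-resolution reduction computes the answer $\theta$, then there exists a term $t' \in \mathbf{Term}(\Sigma)$ such that $t' \in M_P$ and $t'$ is an instance of $\theta(t)$.
   Context: Fix a signature $\Sigma$ of function symbols with arities, containing at least one symbol of arity $0$, and a countably infinite set of variables. $\mathbf{Term}(\Sigma)$ is the set of finite first-order terms over $\Sigma$ (with variables), $\mathbf{GTerm}(\Sigma)$ the set of finite ground (variable-free) terms. A clause is $A \gets B_0,\ldots,B_m$ with $A, B_j \in \mathbf{Term}(\Sigma)$ ($m\ge -1$, i.e. the body may be empty); a logic program $P$ is a finite list of clauses. A substitution $\sigma$ is a matcher of $s$ against $u$ if $\sigma(s)=u$, and a unifier of $s,u$ if $\sigma(s)=\sigma(u)$; mgm/mgu denote most general matcher/unifier. Clause variables are always renamed apart from those of the goal. The least Herbrand model $M_P$ is the smallest set of finite ground terms closed under the rule: if $A\gets B_1,\ldots,B_n$ is a clause of $P$, $\sigma$ is a grounding substitution, and $\sigma(B_1),\ldots,\sigma(B_n)\in M_P$, then $\sigma(A)\in M_P$. Reductions on finite lists of terms: a rewriting step $[t_1,\ldots,t_i,\ldots,t_n]\to_P[t_1,\ldots,t_{i-1},\sigma(B_0),\ldots,\sigma(B_m),t_{i+1},\ldots,t_n]$ if $A\gets B_0,\ldots,B_m$ is a clause of $P$ and $\sigma$ is an mgm of $A$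 against $t_i$ (i.e. $\sigma(A)=t_i$); a substitution step $[t_1,\ldots,t_n]\hookrightarrow_P[\sigma(t_1),\ldots,\sigma(t_n)]$ if some $t_i$ and the head $A$ of some clause of $P$ have mgu $\sigma$. $\to^\mu_P$ denotes reduction by $\to_P$ to a $\to_P$-normal form (a list to which no rewriting step applies). One S-resolution step $\leadsto_{s,P}$ is $\to^\mu_P$ followed by one $\hookrightarrow_P$ step, and $\leadsto_{s,P}^n$ is a sequence of $n$ such steps. The answer computed by such a reduction is the composition $\sigma_k\circ\cdots\circ\sigma_1$ of the substitutions $\sigma_1,\ldots,\sigma_k$ used in its steps, in order. *)

(* Defs.v *)
From mathcomp Require Import all_boot.
From Stdlib Require List.
From Stdlib Require Import Relation_Operators.

Set Implicit Arguments.
Unset Strict Implicit.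
Unset Printing Implicit Defensive.

Record signature := Signature {
  symbol :> Type;
  arity : symbol -> nat
}.

Section Terms.
Variable Sg : signature.

Inductive term : Type :=
| Var of nat
| App (f : Sg) of {ffun 'I_(arity f) -> term}.

Definition substitution := nat -> term.

Fixpoint subst (s : substitution) (t : term) : term :=
  match t with
  | Var x => s x
  | App f a => App [ffun i => subst s (a i)]
  end.

(* [subst_comp s2 s1] applies s1 first. *)
Definition subst_comp (s2 s1 : substitution) : substitution :=
  fun x => subst s2 (s1 x).

Inductive occurs (x : nat) : term -> Prop :=
| OccursVar : occurs x (Var x)
| OccursApp (f : Sg) (a : {ffun 'I_(arity f) -> term}) (i : 'I_(arity f)) :
    occurs x (a i) -> occurs x (App a).

(* GTerm is the subset of Term of the terms satisfying [ground]. *)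
Definition ground (t : term) : Prop := forall x, ~ occurs x t.

Definition grounding (s : substitution) : Prop := forall x, ground (s x).

Definition instance_of (u t : term) : Prop := exists s, u = subst s t.

Definition more_general (s s' : substitution) : Prop :=
  exists r, forall x, s' x = subst_comp r s x.

Definition matcher (s : substitution) (t u : term) : Prop := subst s t = u.

Definition unifier (s : substitution) (t u : term) : Prop :=
  subst s t = subst s u.

(* Substitutions are total functions, compared on all variables.  A most
   general matcher may therefore move variables outside t: the matcher of
   p(x) against p(y) that fixes every variable but x is not more general than
   the swap of x and y.  Rewriting only applies matchers to clause variables,
   where a most general matcher is determined up to renaming of the body
   variables that do not occur in the head. *)
Definition mgm (s : substitution) (t u : term) : Prop :=
  matcher s t u /\ forall s', matcher s' t u -> more_general s s'.

Definition mgu (s : substitution) (t u : term) : Prop :=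
  unifier s t u /\ forall s', unifier s' t u -> more_general s s'.

Record clause := Clause { clause_head : term; clause_body : seq term }.

Definition program := seq clause.

Definition goal := seq term.

Definition subst_clause (s : substitution) (c : clause) : clause :=
  Clause (subst s (clause_head c)) (map (subst s) (clause_body c)).

Definition occurs_clause (x : nat) (c : clause) : Prop :=
  exists2 t, List.In t (clause_head c :: clause_body c) & occurs x t.

Definition occurs_goal (x : nat) (G : goal) : Prop :=
  exists2 t, List.In t G & occurs x t.

(* c is a clause of P renamed apart from the goal G. *)
Definition fresh_variant (P : program) (G : goal) (c : clause) : Prop :=
  (exists (r : nat -> nat) (c0 : clause),
     [/\ bijective r, List.In c0 P & c = subst_clause (fun x => Var (r x)) c0])
  /\ forall x, occurs_clause x c -> ~ occurs_goal x G.

Inductive least_herbrand_model (P : program) : term -> Prop :=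
| LHM (c : clause) (s : substitution) :
    List.In c P -> grounding s ->
    (forall b, List.In b (clause_body c) -> least_herbrand_model P (subst s b)) ->
    least_herbrand_model P (subst s (clause_head c)).

Inductive rewriting_step (P : program) : goal -> goal -> Prop :=
| RewritingStep (G1 : goal) (t : term) (G2 : goal) (c : clause)
    (s : substitution) :
    fresh_variant P (G1 ++ t :: G2) c -> mgm s (clause_head c) t ->
    rewriting_step P (G1 ++ t :: G2) (G1 ++ map (subst s) (clause_body c) ++ G2).

Definition rewriting_normal (P : program) (G : goal) : Prop :=
  ~ exists G', rewriting_step P G G'.

Definition rewrites_to_normal (P : program) (G G' : goal) : Prop :=
  clos_refl_trans goal (rewriting_step P) G G' /\ rewriting_normal P G'.

Inductive substitution_step (P : program) (s : substitution) :
  goal -> goal -> Prop :=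
| SubstitutionStep (G : goal) (t : term) (c : clause) :
    List.In t G -> fresh_variant P G c -> mgu s t (clause_head c) ->
    substitution_step P s G (map (subst s) G).

(* The empty goal admits no substitution step, and a substitution step never
   yields the empty goal.  [SStepEmpty] lets the reduction end as soon as
   rewriting reaches the empty goal; without it no reduction could end in the
   empty goal. *)
Inductive sres_step (P : program) : goal -> substitution -> goal -> Prop :=
| SStep (G N G' : goal) (s : substitution) :
    rewrites_to_normal P G N -> substitution_step P s N G' ->
    sres_step P G s G'
| SStepEmpty (G : goal) :
    rewrites_to_normal P G [::] -> sres_step P G Var [::].

(* [sres P n G th G']: n S-resolution steps from G to G' computing the
   answer th.  Matchers instantiate clauses only, not the goal, so the answer
   composes the unifiers of the substitution steps. *)
Inductive sres (P : program) : nat -> goal -> substitution -> goal -> Prop :=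
| SRes0 (G : goal) : sres P 0 G Var G
| SResS (n : nat) (G G1 G2 : goal) (s th : substitution) :
    sres_step P G s G1 -> sres P n G1 th G2 ->
    sres P n.+1 G (subst_comp th s) G2.

End Terms.

(* Main.v *)
Require Import Defs.
From mathcomp Require Import all_boot.
From Stdlib Require Import List Relation_Operators.

(** Truth in the least Herbrand model is propagated backwards along a
    reduction: for every grounding substitution [g], if [g] sends a goal [G']
    into the model and [G] reduces to [G'] with answer [th], then [g \o th]
    sends [G] into the model.  The empty goal is vacuously in the model, and a
    constant of the signature provides a grounding substitution to start
    from. *)

Section Soundness.
Set Implicit Arguments.

Variable Sg : signature.
Implicit Types (t : term Sg) (s g : substitution Sg) (P : program Sg).
Implicit Types (G : goal Sg) (c : clause Sg).

(* The generated [term_ind] has no induction hypothesis for arguments. *)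
Lemma term_args_ind (Q : term Sg -> Prop) :
  (forall x, Q (Var Sg x)) ->
  (forall (f : Sg) (a : {ffun 'I_(arity f) -> term Sg}),
     (forall i, Q (a i)) -> Q (App a)) ->
  forall t, Q t.
Proof.
move=> QVar QApp; fix IH 1 => -[x | f a]; first exact: QVar.
by apply: QApp => i; apply: IH.
Qed.

Lemma subst_comp_app s2 s1 t :
  subst (subst_comp s2 s1) t = subst s2 (subst s1 t).
Proof.
elim/term_args_ind: t => [//|f a IH] /=.
by congr App; apply/ffunP => i; rewrite !ffunE IH.
Qed.

Lemma subst_Var t : subst (@Var Sg) t = t.
Proof.
elim/term_args_ind: t => [//|f a IH] /=.
by congr App; apply/ffunP => i; rewrite !ffunE IH.
Qed.

Lemma occurs_App x (f : Sg) (a : {ffun 'I_(arity f) -> term Sg}) :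
  occurs x (App a) -> exists i, occurs x (a i).
Proof.
(* The type of [a] depends on [f], so inverting [occurs x (App a)] directly would leave an equality
   of dependent pairs. A match on an arbitrary term avoids it. *)
have: forall t, occurs x t ->
    if t is App _ b then exists i, occurs x (b i) else True.
  by move=> t [//|h b i xi]; exists i.
by move=> H /H.
Qed.

Lemma ground_subst g t : grounding g -> ground (subst g t).
Proof.
move=> gg; elim/term_args_ind: t => [x|f a IH] /=; first exact: gg.
by move=> x /occurs_App[i]; rewrite ffunE; apply: IH.
Qed.

Lemma grounding_comp g s : grounding g -> grounding (subst_comp g s).
Proof. by move=> gg x; apply: ground_subst. Qed.

Definition goal_holds P g G : Prop :=
  forall t, In t G -> least_herbrand_model P (subst g t).

(** The renaming is absorbed into [g]: their composite is still grounding, so the closure rule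
    applies to the original clause of [P]. *)
Lemma fresh_variant_sound P G c g :
  fresh_variant P G c -> grounding g -> goal_holds P g (clause_body c) ->
  least_herbrand_model P (subst g (clause_head c)).
Proof.
move=> [[r [c0 [_ c0P ->]]] _] gg body /=.
rewrite -subst_comp_app; apply: LHM => // [|b bc0]; first exact: grounding_comp.
by rewrite subst_comp_app; apply: body; apply: in_map.
Qed.

(** Matching makes the rewritten term equal to [subst s (clause_head c)], so its [g]-instance is the
    head of [c] under the grounding substitution [subst_comp g s], whose body instances lie in
    [G']. *)
Lemma rewriting_step_sound P G G' g :
  rewriting_step P G G' -> grounding g -> goal_holds P g G' ->
  goal_holds P g G.
Proof.
case=> G1 t G2 c s fresh [<- _] gg holds u.
case/in_app_iff => [uG1 | [<- | uG2]]; last first.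
- by apply: holds; rewrite !in_app_iff; right; right.
- rewrite -subst_comp_app; apply: fresh_variant_sound fresh _ _.
    exact: grounding_comp.
  move=> b bc; rewrite subst_comp_app; apply: holds.
  by rewrite !in_app_iff; right; left; apply: in_map.
by apply: holds; rewrite in_app_iff; left.
Qed.

Lemma rewrites_sound P G G' g :
  clos_refl_trans _ (rewriting_step P) G G' -> grounding g ->
  goal_holds P g G' -> goal_holds P g G.
Proof.
move=> red gg; elim: red => {G G'} [G G' step|//|G1 G2 G3 _ IH12 _ IH23].
  exact: rewriting_step_sound step gg.
by move=> /IH23 /IH12.
Qed.

Lemma sres_step_sound P G s G' g :
  sres_step P G s G' -> grounding g -> goal_holds P g G' ->
  goal_holds P (subst_comp g s) G.
Proof.
case=> {G s G'} [G N G' s [red _] step | G [red _]] gg holds.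
  (* The rewriting phase precedes the unifier, so it is traversed with [subst_comp g s] in place of
     [g]. *)
  apply: rewrites_sound red (grounding_comp _ gg) _.
  case: step holds => {}N t c _ _ _ holds u uN.
  by rewrite subst_comp_app; apply: holds; apply: in_map.
move=> u uG; rewrite subst_comp_app subst_Var.
exact: rewrites_sound red gg holds u uG.
Qed.

Lemma sres_sound P n G th G' g :
  sres P n G th G' -> grounding g -> goal_holds P g G' ->
  goal_holds P (subst_comp g th) G.
Proof.
move=> red gg; elim: red => {n G th G'} [G|n G G1 G2 s th step _ IH] holds u uG.
  by rewrite subst_comp_app subst_Var; apply: holds.
(* The first step is taken with [subst_comp g th], the grounding substitution that the induction
   hypothesis provides for [G1]. *)
have := sres_step_sound step (grounding_comp _ gg) (IH holds) u uG.
by rewrite !subst_comp_app.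
Qed.

Lemma exists_grounding :
  (exists f : Sg, arity f = 0) -> exists g : substitution Sg, grounding g.
Proof.
(* Every variable goes to the constant [f]; [Var Sg i] is only a filler, since ['I_(arity f)] is
   empty. *)
move=> [f f0]; exists (fun=> App [ffun i : 'I_(arity f) => Var Sg i]).
by move=> _ y /occurs_App[[i lti] _]; rewrite f0 in lti.
Qed.

End Soundness.

Theorem theorem2p13 (Sg : signature) (hconst : exists c : Sg, arity c = 0)
    (P : program Sg) (t : term Sg) (n : nat) (th : substitution Sg)
    (hred : sres P n [:: t] th [::]) :
  exists t' : term Sg,
    least_herbrand_model P t' /\ instance_of t' (subst th t).
Proof.
have [g gg] := exists_grounding _ hconst.
exists (subst g (subst th t)); split; last by exists g.
rewrite -subst_comp_app.
by apply: (sres_sound hred gg) => //; left.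
Qed.
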